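(* For the real Banach space $\mathbb{R}$ (with the absolute value as norm), $\Phi_{\mathbb{R}}(\delta)=\delta$ if $0<\delta\leq 1$, $\Phi_{\mathbb{R}}(\delta)=\sqrt{\delta-1}+1$ if $1<\delta<2$, and $\Phi_{\mathbb{R}}^S(\delta)=0$ for every $\delta\in(0,2)$.
   Context: For a (real or complex) Banach space $X\neq\{0\}$, $B_X$ and $S_X$ denote its closed unit ball and unit sphere, $X^*$ its topological dual, and $\Pi(X):=\{(x,x^* )\in X\times X^* : \|x\|=\|x^*\|=x^*(x)=1\}$. The Bishop-Phelps-Bollobás modulus $\Phi_X:(0,2)\to[0,\infty)$ is defined as follows: $\Phi_X(\delta)$ is the infimum of those $\varepsilon>0$ such that for every $(x,x^* )\in B_X\times B_{X^*}$ with $\operatorname{Re} x^*(x)>1-\delta$ there is $(y,y^* )\in\Pi(X)$ with $\|x-y\|<\varepsilon$ and $\|x^*-y^*\|<\varepsilon$. The spherical Bishop-Phelps-Bollobás modulus $\Phi_X^S:(0,2)\to[0,\infty)$ is defined in the same way with $B_X\times B_{X^*}$ replaced by $S_X\times S_{X^*}$. *)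

(* Defs.v *)
From HB Require Import structures.
From mathcomp Require Import all_boot all_order all_algebra.
From mathcomp Require Import all_classical all_reals all_analysis.
Set Implicit Arguments.
Unset Strict Implicit.
Unset Printing Implicit Defensive.
Import Order.TTheory GRing.Theory Num.Theory.
Import numFieldNormedType.Exports.
Local Open Scope classical_set_scope.
Local Open Scope ring_scope.

(* Everything is stated for real Banach spaces, so [Re] is the identity.      *)

Section BishopPhelpsBollobas.
Context {R : realType}.
Variable X : completeNormedModType R.

Definition dual : set {linear X -> R^o} :=
  [set f | continuous (f : X -> R^o)].

(* [sup] takes a junk value on unbounded sets; below, this norm is only       *)
(* applied to elements of [dual] and to differences of such elements.         *)
Definition dual_norm (f : X -> R^o) : R :=
  sup [set `|f x| | x in [set x : X | `|x| <= 1]].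

Definition ball_pairs : set (X * {linear X -> R^o}) :=
  [set p | [/\ dual p.2, `|p.1| <= 1 & dual_norm p.2 <= 1]].

Definition sphere_pairs : set (X * {linear X -> R^o}) :=
  [set p | [/\ dual p.2, `|p.1| = 1 & dual_norm p.2 = 1]].

Definition norming_pairs : set (X * {linear X -> R^o}) :=
  [set p | [/\ dual p.2, `|p.1| = 1, dual_norm p.2 = 1 & p.2 p.1 = 1]].

Definition BPB_admissible (D : set (X * {linear X -> R^o})) (delta : R)
    : set R :=
  [set eps | 0 < eps /\
     forall p, D p -> p.2 p.1 > 1 - delta ->
       exists q, [/\ norming_pairs q, `|p.1 - q.1| < eps &
                     dual_norm (p.2 \- q.2) < eps]].

(* The infimum is taken in the extended reals, so that an equation            *)
(* [BPB_modulus delta = r%:E] rules out an empty set of admissible values;    *)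
(* with the real-valued [inf] the empty set would yield 0.                    *)
Definition BPB_modulus (delta : R) : \bar R :=
  ereal_inf [set eps%:E | eps in BPB_admissible ball_pairs delta].

Definition spherical_BPB_modulus (delta : R) : \bar R :=
  ereal_inf [set eps%:E | eps in BPB_admissible sphere_pairs delta].

End BishopPhelpsBollobas.

(* Main.v *)
Require Import Defs.
From HB Require Import structures.
From mathcomp Require Import all_boot all_order all_algebra.
From mathcomp Require Import all_classical all_reals all_analysis.
From mathcomp Require Import lra.
Import Order.TTheory GRing.Theory Num.Theory.
Import numFieldNormedType.Exports.
Local Open Scope classical_set_scope.
Local Open Scope ring_scope.

(** A functional on the line is multiplication by its slope, whose absolute
    value is its norm, and the norming pairs are [(1, 1)] and [(-1, -1)]. So the
    modulus at [delta] measures how far a point [(x, t)] of the square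
    [[-1, 1]^2] with [x * t > 1 - delta] can be from both of these corners in
    the max norm. For [delta <= 1] the extremal points approach
    [(1 - delta, 1)]; for [delta > 1] they approach [(a, - a)] with
    [a = Num.sqrt (delta - 1)]. On the sphere [x * t] is [1] or [-1], so the
    pair is itself norming. *)

Section RealLine.
Context {R : realType}.
Implicit Types (f : {linear R^o -> R^o}) (x t s delta eps : R).

Lemma linear_slopeE f x : f x = x * f 1.
Proof. by rewrite -[in LHS](mulr1 x) -[x * 1]/(x *: (1 : R^o)) linearZ. Qed.

(** The supremum is attained at [1]. Taking a bare function [g] lets this apply to differences
    [f \- g] as well. *)
Lemma dual_norm_slope (g : R^o -> R^o) t :
  (forall x, g x = x * t) -> dual_norm (X := R^o) g = `|t|.
Proof.
move=> gE; apply/eqP; rewrite eq_le; apply/andP; split.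
- apply: ge_sup; first by exists `|g 0|, 0 => //=; rewrite normr0.
  by move=> _ [x /= x1 <-]; rewrite gE normrM ler_piMl.
- apply: ub_le_sup; last by exists 1; rewrite /= ?normr1// gE mul1r.
  by exists `|t| => _ [x /= x1 <-]; rewrite gE normrM ler_piMl.
Qed.

Lemma dual_norm_linear f : dual_norm f = `|f 1|.
Proof. by apply: dual_norm_slope; exact: linear_slopeE. Qed.

Lemma dual_linear f : dual f.
Proof.
rewrite /dual /= (_ : (f : R^o -> R^o) = (fun x : R => x * f 1 : R)).
  by move=> x; apply: mulrr_continuous.
by apply/funext => x; exact: linear_slopeE.
Qed.

Lemma linear_of_slope t : exists f, f 1 = t.
Proof.
have h : linear (fun x : R^o => x * t : R^o).
  by move=> a x y /=; rewrite mulrDl scalerAl.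
pose L := GRing.isLinear.Build R R^o R^o *:%R (fun x : R^o => x * t : R^o) h.
pose g : {linear R^o -> R^o} := HB.pack (fun x : R^o => x * t : R^o) L.
by exists g; rewrite /= mul1r.
Qed.

(** Since [x * x = 1], the equation [x * f 1 = 1] forces [f 1 = x]; a single sign thus determines
    the pair. *)
Lemma norming_pairsE (x : R^o) f :
  norming_pairs (x, f) <-> `|x| = 1 /\ f 1 = x :> R.
Proof.
rewrite /norming_pairs /= dual_norm_linear; split.
- move=> [_ x1 _]; rewrite (linear_slopeE f x) => xf; split => //.
  have xx : x * x = 1 by rewrite -expr2 -real_normK ?num_real// x1 expr1n.
  have x0 : x != 0 by rewrite -normr_eq0 x1 oner_eq0.
  by apply: (mulfI x0); rewrite xf xx.
- move=> [x1 fx]; split=> //; [exact: dual_linear | by rewrite fx |].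
  by rewrite (linear_slopeE f) fx -expr2 -real_normK ?num_real// x1 expr1n.
Qed.

(** Passing to slopes leaves a condition on two real numbers. [P] is kept abstract so that ball and
    sphere share the proof. *)
Lemma BPB_admissibleE (D : set (R^o * {linear R^o -> R^o}))
    (P : R -> R -> Prop) delta eps :
  (forall x f, D (x : R^o, f) <-> P x (f 1)) ->
  BPB_admissible D delta eps <->
  0 < eps /\ forall x t, P x t -> 1 - delta < x * t ->
    exists s, [/\ `|s| = 1, `|x - s| < eps & `|t - s| < eps].
Proof.
move=> DP; split=> -[eps0 H]; split=> //.
- move=> x t Pxt xt; have [f ft] := linear_of_slope t.
  have [||[y g] /= [/norming_pairsE[y1 gy] xy fg]] := H (x : R^o, f).
  + by apply/DP; rewrite ft.
  + by rewrite /= (linear_slopeE f) ft.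
  exists y; split => //; rewrite -(@dual_norm_slope (f \- g)) // => z.
  by rewrite /= (linear_slopeE f) (linear_slopeE g) ft gy mulrBr.
- move=> [x f] /DP Pxf /=; rewrite (linear_slopeE f) => xf.
  have [s [s1 xs fs]] := H _ _ Pxf xf.
  have [g gs] := linear_of_slope s.
  exists (s : R^o, g); split => //=; first exact/norming_pairsE.
  rewrite (@dual_norm_slope (f \- g) (f 1 - s)) // => z.
  by rewrite /= (linear_slopeE f) (linear_slopeE g) gs mulrBr.
Qed.

Lemma ball_admissibleE delta eps :
  BPB_admissible (@ball_pairs R R^o) delta eps <->
  0 < eps /\ forall x t, `|x| <= 1 /\ `|t| <= 1 -> 1 - delta < x * t ->
    exists s, [/\ `|s| = 1, `|x - s| < eps & `|t - s| < eps].
Proof.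
apply: (BPB_admissibleE _ (fun x t => `|x| <= 1 /\ `|t| <= 1)) => x f.
rewrite /ball_pairs /= dual_norm_linear; split=> [[]//|[? ?]].
by split=> //; exact: dual_linear.
Qed.

Lemma sphere_admissibleE delta eps :
  BPB_admissible (@sphere_pairs R R^o) delta eps <->
  0 < eps /\ forall x t, `|x| = 1 /\ `|t| = 1 -> 1 - delta < x * t ->
    exists s, [/\ `|s| = 1, `|x - s| < eps & `|t - s| < eps].
Proof.
apply: (BPB_admissibleE _ (fun x t => `|x| = 1 /\ `|t| = 1)) => x f.
rewrite /sphere_pairs /= dual_norm_linear; split=> [[]//|[? ?]].
by split=> //; exact: dual_linear.
Qed.

(** Whether [r] lies in [A] is left open: on the sphere the infimum [0] is not admissible. *)
Lemma ereal_inf_EFinE (A : set R) (r : R) :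
  (forall e, A e -> r <= e) -> (forall e, r < e -> A e) ->
  ereal_inf [set e%:E | e in A] = r%:E.
Proof.
move=> Ar rA; apply/eqP; rewrite eq_le; apply/andP; split.
- apply/lee_addgt0Pr => e e0; apply: ereal_inf_lbound.
  by exists (r + e) => //; apply: rA; rewrite ltrDl.
- by apply: le_ereal_inf_tmp => _ [e Ae <-]; rewrite lee_fin Ar.
Qed.

Lemma normr1P s : `|s| = 1 -> s = 1 \/ s = -1.
Proof.
move=> s1; have [s0|s0] := lerP 0 s.
  by left; rewrite -s1 ger0_norm.
by right; rewrite -s1 ltr0_norm ?opprK.
Qed.

(** The corner [s] is the common sign of [x] and [t]; negating both reduces to [0 <= x]. *)
Lemma same_sign_corner x t : `|x| <= 1 -> `|t| <= 1 -> 0 <= x * t ->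
  exists s, [/\ `|s| = 1, `|x - s| = 1 - `|x| & `|t - s| = 1 - `|t|].
Proof.
wlog x0 : x t / 0 <= x => [H|] x1 t1 xt.
  have [x0|x0] := leP 0 x; first exact: H.
  have [||||s [s1 xs ts]] := H (- x) (- t).
  - by rewrite oppr_ge0 ltW.
  - by rewrite normrN.
  - by rewrite normrN.
  - by rewrite mulrNN.
  exists (- s); rewrite normrN -(normrN x) -(normrN t) -xs -ts.
  by split=> //; rewrite opprK -[LHS]normrN opprD.
have [t0|t0] := leP 0 t.
  exists 1; rewrite normr1 (ger0_norm x0) (ger0_norm t0).
  move: x1 t1; rewrite (ger0_norm x0) (ger0_norm t0) => x1 t1.
  by rewrite !ler0_norm ?subr_le0 // !opprB.
have x00 : x = 0 by nra.
exists (- 1); rewrite normrN1 x00 normr0 (ltr0_norm t0) !opprK add0r normr1.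
move: t1; rewrite (ltr0_norm t0) => t1.
by rewrite subr0 ger0_norm; [split=> //; lra | lra].
Qed.

(** The corner shared by [- x] and [t] is near [t] and on the far side of [0] from [x]. *)
Lemma opposite_sign_corner x t : `|x| <= 1 -> `|t| <= 1 -> x * t <= 0 ->
  exists s, [/\ `|s| = 1, `|x - s| = 1 + `|x| & `|t - s| = 1 - `|t|].
Proof.
move=> x1 t1 xt.
have [||| s [s1 xs ts]] := @same_sign_corner (- x) t; rewrite ?normrN//.
  by rewrite mulNr oppr_ge0.
exists s; rewrite normrN in xs; split => //.
move: xs {ts}; have [-> | ->] := normr1P _ s1 => xs.
  (* The distance [xs] reveals the sign of [x]: it gives [x + 1 <= 1 - |x|]. *)
  have x0 : x <= 0.
    by have := ler_norm (- (- x - 1)); rewrite normrN xs; have := normr_ge0 x; lra.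
  by rewrite (ler0_norm x0) ler0_norm; lra.
have x0 : 0 <= x.
  by have := ler_norm (- x - - 1); rewrite xs; have := normr_ge0 x; lra.
by rewrite (ger0_norm x0) ger0_norm; lra.
Qed.

Lemma BPB_modulus_le1 delta : 0 < delta <= 1 ->
  BPB_modulus R^o delta = delta%:E.
Proof.
move=> /andP[d0 d1]; apply: ereal_inf_EFinE => eps.
- move=> /ball_admissibleE[e0 H]; rewrite leNgt.
  apply/negP => ed.
  (* The point [1 - eps] is at distance exactly [eps] from [1], and at distance [2 - eps > eps] from
     [-1]. *)
  have [|| s [/normr1P + + _]] := H (1 - eps) 1; last first.
    case=> ->; first by rewrite addrAC subrr sub0r normrN gtr0_norm ?ltxx.
    by rewrite ger0_norm; lra.
  + by rewrite mulr1; lra.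
  + by rewrite normr1; split => //; rewrite ger0_norm; lra.
- move=> de; apply/ball_admissibleE; split; first lra.
  move=> x t [x1 t1] xt.
  have xt0 : 0 <= x * t by lra.
  have [s [s1 xs ts]] := same_sign_corner _ _ x1 t1 xt0.
  (* Both factors are at most [1] in absolute value, so each exceeds [1 - delta]. *)
  have := ler_norm (x * t); rewrite normrM => nxt.
  have nx := normr_ge0 x; have nt := normr_ge0 t.
  by exists s; split=> //; rewrite ?xs ?ts; nra.
Qed.

Lemma BPB_modulus_gt1 delta : 1 < delta < 2 ->
  BPB_modulus R^o delta = (Num.sqrt (delta - 1) + 1)%:E.
Proof.
move=> /andP[d1 d2]; set a := Num.sqrt _.
have aE : a * a = delta - 1 by rewrite -expr2 sqr_sqrtr// subr_ge0 ltW.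
have a0 : 0 < a by rewrite sqrtr_gt0 subr_gt0.
have a1 : a < 1 by nra.
apply: ereal_inf_EFinE => eps.
- move=> /ball_admissibleE[e0 H]; rewrite leNgt.
  apply/negP => ea.
  (* Either corner is at distance [b + 1] from one coordinate of [(b, - b)], and [b < a] gives
     [- b * b > 1 - delta]. *)
  have [b [b0 ba eb]] : exists b, [/\ 0 <= b, b < a & eps <= b + 1].
    have [e1|e1] := leP eps 1; first by exists 0; split=> //; lra.
    by exists (eps - 1); split; lra.
  have [|| s [/normr1P + + +]] := H b (- b); last first.
    case=> ->; first by move=> _; rewrite -opprD normrN ger0_norm; lra.
    by rewrite opprK => + _; rewrite ger0_norm; lra.
  + by nra.
  + by rewrite normrN ger0_norm //; split; lra.
- move=> ae; apply/ball_admissibleE; split; first lra.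
  move=> x t [x1 t1] xt; have nx := normr_ge0 x; have nt := normr_ge0 t.
  have [xt0|xt0] := leP 0 (x * t).
    have [s [s1 xs ts]] := same_sign_corner _ _ x1 t1 xt0.
    by exists s; split=> //; rewrite ?xs ?ts; lra.
  have nxt : `|x| * `|t| < a * a by rewrite -normrM ltr0_norm //; lra.
  (* The coordinate of smaller absolute value is below [a] in absolute value; choosing the corner by
     the sign of the other one keeps both distances below [a + 1]. *)
  have [lext|letx] := leP `|x| `|t|.
    have [s [s1 xs ts]] := opposite_sign_corner _ _ x1 t1 (ltW xt0).
    by exists s; split=> //; rewrite ?xs ?ts; nra.
  rewrite mulrC in xt0.
  have [s [s1 ts xs]] := opposite_sign_corner _ _ t1 x1 (ltW xt0).
  by exists s; split=> //; rewrite ?xs ?ts; nra.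
Qed.

Lemma spherical_BPB_modulus_eq0 delta : 0 < delta < 2 ->
  spherical_BPB_modulus R^o delta = 0%:E.
Proof.
move=> /andP[d0 d2]; apply: ereal_inf_EFinE => eps; first by case=> /ltW.
move=> e0; apply/sphere_admissibleE; split => //.
move=> x t [x1 t1] xt; exists x; split=> //; first by rewrite subrr normr0.
suff -> : t = x by rewrite subrr normr0.
(* Opposite signs would give [x * t = -1], which is less than [1 - delta] as [delta < 2]. *)
by move: xt; have [-> | ->] := normr1P _ x1; have [-> | ->] := normr1P _ t1; lra.
Qed.

End RealLine.

Theorem mainTheorem6 (R : realType) :
  [/\ forall delta : R, 0 < delta <= 1 ->
        BPB_modulus R^o delta = delta%:E,
      forall delta : R, 1 < delta < 2 ->
        BPB_modulus R^o delta = (Num.sqrt (delta - 1) + 1)%:E &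
      forall delta : R, 0 < delta < 2 ->
        spherical_BPB_modulus R^o delta = 0%:E].
Proof.
split.
- exact: BPB_modulus_le1.
- exact: BPB_modulus_gt1.
- exact: spherical_BPB_modulus_eq0.
Qed.
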